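(* Let $\mathcal{H}_1$ and $\mathcal{H}_2$ be two real Hilbert spaces, let $B_1:\mathcal{H}_1\to 2^{\mathcal{H}_1}$ and $F_1:\mathcal{H}_2\to 2^{\mathcal{H}_2}$ be two set-valued, odd and maximal monotone mappings, and let $A:\mathcal{H}_1\to\mathcal{H}_2$ be a bounded linear operator with adjoint $A^*$. Put $L=\|A^*A\|$ and $$\Gamma:=\{x\in\mathcal{H}_1 \mid 0\in B_1(x)\ \text{and}\ 0\in F_1(A(x))\}.$$ Let $\lambda>0$. If $\gamma\in(0,2/L)$, then for every starting point $x^0\in\mathcal{H}_1$ the sequence $\{x^k\}_{k=0}^\infty$ generated by $$x^{k+1}=J_\lambda^{B_1}\left(x^k-\gamma A^*(I-J_\lambda^{F_1})A(x^k)\right),\qquad k\ge 0,$$ converges strongly (in norm) to a point $x^*\in\Gamma$.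
   Context: A set-valued mapping $B:\mathcal{H}\to 2^{\mathcal{H}}$ on a real Hilbert space $\mathcal{H}$ is monotone if $\langle u-v,x-y\rangle\ge 0$ for all $u\in B(x)$ and $v\in B(y)$; it is maximal monotone if it is monotone and its graph $G(B)=\{(x,u)\in\mathcal{H}\times\mathcal{H}\mid u\in B(x)\}$ is not properly contained in the graph of any other monotone mapping. $B$ is odd if $B(-x)=-B(x)$ for all $x\in\mathcal{H}$. For $\lambda>0$ the resolvent of $B$ is $J_\lambda^B:=(I+\lambda B)^{-1}$, where $I$ is the identity operator; it is well known that for maximal monotone $B$ it is single-valued and defined on all of $\mathcal{H}$. *)

(* Defs.v *)
From HB Require Import structures.
From mathcomp Require Import all_boot all_order all_algebra.
From mathcomp Require Import sesquilinear.
From mathcomp Require Import all_classical all_reals all_analysis.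
Set Implicit Arguments.
Unset Strict Implicit.
Unset Printing Implicit Defensive.
Import Order.TTheory GRing.Theory Num.Theory.
Import numFieldNormedType.Exports.
Local Open Scope classical_set_scope.
Local Open Scope ring_scope.

(* The norm of the underlying Banach space is the one induced by the inner
   product. *)
HB.mixin Record CompleteNormedModule_isHilbert (R : realType) H
    of CompleteNormedModule R H := {
  inner : {dot H for (idfun : R -> R)} ;
  sqr_norm_inner : forall x : H, `|x| ^+ 2 = inner x x
}.

#[short(type="hilbertType")]
HB.structure Definition Hilbert (R : realType) :=
  {H of CompleteNormedModule_isHilbert R H & CompleteNormedModule R H}.

Section BoundedOperators.
Context {R : realType}.

Definition opnorm {V W : normedModType R} (f : V -> W) : R :=
  sup [set `|f x| | x in [set x : V | `|x| <= 1]].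

(* For A linear and bounded, the Riesz representation theorem gives exactly
   one z as below; the default value 0 of xget is then never used. *)
Definition adjoint {H1 H2 : hilbertType R} (A : H1 -> H2) (y : H2) : H1 :=
  xget 0 [set z | forall x : H1, inner (A x) y = inner x z].

End BoundedOperators.

Section SetValuedMappings.
Context {R : realType} {H : hilbertType R}.
Implicit Types (B : H -> set H) (lambda : R).

Definition graph B : set (H * H) := [set p | B p.1 p.2].

Definition monotone_map B : Prop :=
  forall x y u v, B x u -> B y v -> 0 <= inner (u - v) (x - y).

Definition maximal_monotone B : Prop :=
  monotone_map B /\
  forall B', monotone_map B' -> ~ (graph B `<` graph B').

Definition odd_map B : Prop := forall x, B (- x) = -%R @` B x.

Definition inverse_map B : H -> set H := fun z => [set x | B x z].

(* I + lambda B *)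
Definition id_add_scale lambda B : H -> set H :=
  fun x => [set x + lambda *: u | u in B x].

Definition resolvent_map lambda B : H -> set H :=
  inverse_map (id_add_scale lambda B).

(* The resolvent as a function: for B maximal monotone and 0 < lambda,
   resolvent_map lambda B z is a singleton for every z (Minty's theorem), so
   the default value 0 of xget is never used. *)
Definition resolvent lambda B (z : H) : H := xget 0 (resolvent_map lambda B z).

End SetValuedMappings.

Definition solution_set {R : realType} {H1 H2 : hilbertType R}
    (B1 : H1 -> set H1) (F1 : H2 -> set H2) (A : H1 -> H2) : set H1 :=
  [set x | B1 x 0 /\ F1 (A x) 0].

(* Main.v *)
(* The iteration x k.+1 = S (x k) is governed by a map S that is odd and
   nonexpansive, because resolvents of odd maximal monotone maps are odd and
   firmly nonexpansive and gamma L < 2. Comparing x k with - x k shows that both the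
   residuals A x - J A x and the differences x k.+1 - x k tend to 0. By oddness
   |x n + x k| is nonincreasing along the orbit, so the parallelogram law makes
   (x k) a Cauchy sequence (Baillon-Bruck-Reich), and its limit solves the
   problem since the graphs of B1 and F1 are closed. That resolvents are defined
   everywhere (Minty) and that the adjoint exists (Riesz) both come from
   minimising a strongly convex function. *)

Require Import Defs.
From HB Require Import structures.
From mathcomp Require Import all_boot all_order all_algebra.
From mathcomp Require Import sesquilinear.
From mathcomp Require Import all_classical all_reals all_analysis.
From mathcomp Require Import ring lra.
Set Implicit Arguments.
Unset Strict Implicit.
Unset Printing Implicit Defensive.
Import Order.TTheory GRing.Theory Num.Theory.
Import numFieldNormedType.Exports.
Local Open Scope classical_set_scope.
Local Open Scope ring_scope.

(** * Inner product calculus *)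

Section Inner.
Context {R : realType} {H : hilbertType R}.
Implicit Types (x y z : H) (a : R).

Lemma innerC x y : inner x y = inner y x.
Proof. by rewrite hermC expr0 mul1r. Qed.

Lemma innerDl x y z : inner (x + y) z = inner x z + inner y z.
Proof. exact: linearDl. Qed.

Lemma innerDr x y z : inner x (y + z) = inner x y + inner x z.
Proof. exact: linearDr. Qed.

Lemma innerNl x y : inner (- x) y = - inner x y.
Proof. exact: linearNl. Qed.

Lemma innerNr x y : inner x (- y) = - inner x y.
Proof. exact: linearNr. Qed.

Lemma inner0l y : inner 0 y = 0.
Proof. exact: linear0l. Qed.

Lemma inner0r x : inner x 0 = 0.
Proof. exact: linear0r. Qed.

Lemma innerZl a x y : inner (a *: x) y = a * inner x y.
Proof. exact: linearZl_LR. Qed.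

Lemma innerZr a x y : inner x (a *: y) = a * inner x y.
Proof. by rewrite innerC innerZl innerC. Qed.

Definition innerE := (innerDl, innerDr, innerNl, innerNr,
  inner0l, inner0r, innerZl, innerZr).

Lemma sqr_normD x y : `|x + y| ^+ 2 = `|x| ^+ 2 + `|y| ^+ 2 + 2 * inner x y.
Proof. rewrite !sqr_norm_inner !innerE (innerC y x); lra. Qed.

Lemma sqr_normB x y : `|x - y| ^+ 2 = `|x| ^+ 2 + `|y| ^+ 2 - 2 * inner x y.
Proof. rewrite !sqr_norm_inner !innerE (innerC y x); lra. Qed.

Lemma sqr_normZ a x : `|a *: x| ^+ 2 = a ^+ 2 * `|x| ^+ 2.
Proof. by rewrite !sqr_norm_inner !innerE mulrA expr2. Qed.

Lemma sqr_norm_double x : `|x + x| ^+ 2 = 4 * `|x| ^+ 2.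
Proof. by rewrite sqr_normD -sqr_norm_inner; lra. Qed.

(** Vector identities are proved below by testing against an arbitrary [z], which leaves linear
    arithmetic over [R]. *)
Lemma inner_injr x y : (forall z, inner z x = inner z y) -> x = y.
Proof.
move=> h; apply/eqP; rewrite -subr_eq0 -normr_eq0 -sqrf_eq0 sqr_norm_inner.
by rewrite innerDr innerNr h subrr.
Qed.

Lemma inner_le_norm x y : inner x y <= `|x| * `|y|.
Proof.
have [->|x0] := eqVneq x 0; first by rewrite innerE normr0 mul0r.
have [->|y0] := eqVneq y 0; first by rewrite innerE normr0 mulr0.
(* Expanding this square gives Cauchy-Schwarz multiplied by [2 * |x| * |y|]. *)
have := sqr_ge0 `|(`|y| *: x - `|x| *: y)|.
rewrite sqr_normB !sqr_normZ !innerE.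
have := normr_gt0 x; have := normr_gt0 y; rewrite x0 y0 => yp xp.
have p : 0 < `|x| * `|y| by rewrite mulr_gt0.
by move=> h; rewrite -(ler_pM2l p); nra.
Qed.

(** Polarisation reduces this to continuity of the norm. *)
Lemma cvg_inner (f g : nat -> H) x y :
  f @ \oo --> x -> g @ \oo --> y -> (fun n => inner (f n) (g n)) @ \oo --> inner x y.
Proof.
have polar (u v : H) : inner u v = 4^-1 * (`|u + v| * `|u + v| - `|u - v| * `|u - v|).
  by rewrite -!expr2 sqr_normD sqr_normB; field.
move=> fx gy; rewrite polar; under eq_fun do rewrite polar.
apply: cvgMr; apply: cvgB; apply: cvgM; apply: cvg_norm;
  by [apply: cvgD | apply: cvgB].
Qed.

End Inner.

(** * Limits, Cauchy criteria and minimising sequences *)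

Section Sequences.
Context {R : realType}.

(** Divide by [s] and let it tend to 0: this is the first-order condition at a minimiser, used for
    Riesz and for Minty. *)
Lemma ge0_of_small (C D : R) :
  (forall s, 0 < s -> s < 1 -> 0 <= s * C + s ^+ 2 * D) -> 0 <= C.
Proof.
move=> h; rewrite leNgt; apply/negP => C0.
(* If [C < 0], this [M] makes [s = - C / M] satisfy both [s < 1] and [s * |D| < - C]. *)
pose M := 1 + `|D| - C.
have D0 := normr_ge0 D; have DM := ler_norm D.
have M0 : 0 < M by rewrite /M; lra.
have s0 : 0 < - C / M by rewrite divr_gt0 // oppr_gt0.
have s1 : - C / M < 1 by rewrite ltr_pdivrMr // mul1r /M; lra.
have := h _ s0 s1; set s := - C / M.
have sM : s * M = - C by rewrite /s mulfVK ?gt_eqF.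
rewrite expr2 -mulrA -mulrDr pmulr_rge0 //.
have : s * D <= s * `|D| by rewrite ler_pM2l.
rewrite /M in sM; nra.
Qed.

Lemma cvg_of_sqr_dist (V : completeNormedModType R) (x : nat -> V) (e : nat -> R) :
  e @ \oo --> 0 -> (forall n k, `|x n - x k| ^+ 2 <= e n + e k) -> cvgn x.
Proof.
move=> e0 h; apply/cauchy_cvgP/cauchy_ballP => r r0.
have r2 : 0 < r ^+ 2 / 2 by rewrite divr_gt0 // exprn_gt0.
have ee : \forall n \near \oo, `|e n| < r ^+ 2 / 2 by exact: cvgr0_norm_lt.
pose S := [set n | `|e n| < r ^+ 2 / 2].
have xS : \forall n \near \oo, (x @` S) (x n).
  by apply: filterS ee => n en; exists n.
exists (x @` S, x @` S) => //.
case=> _ _ [/= [n en <-] [k ek <-]].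
rewrite -ball_normE /ball_ /=.
rewrite -(ltr_pXn2r (n := 2)) ?nnegrE ?normr_ge0 ?ltW //.
apply: le_lt_trans (h n k) _.
rewrite /S /= in en ek.
have := ler_norm (e n); have := ler_norm (e k); lra.
Qed.

Lemma cvgn_le (f g : nat -> R) (a b : R) :
  f @ \oo --> a -> g @ \oo --> b -> (forall n, f n <= g n) -> a <= b.
Proof.
move=> fa gb h.
rewrite -(cvg_lim (@norm_hausdorff _ R) fa) -(cvg_lim (@norm_hausdorff _ R) gb).
by apply: ler_lim; [exact: cvgP fa | exact: cvgP gb | exact: nearW].
Qed.

Lemma cvg_of_dist_le (V : normedModType R) (x : nat -> V) (l : V) (e : nat -> R) :
  e @ \oo --> 0 -> (forall n, `|x n - l| <= e n) -> x @ \oo --> l.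
Proof.
move=> e0 h; apply/cvgrPdist_le => r r0.
have : \forall n \near \oo, `|e n| < r by exact: cvgr0_norm_lt.
apply: filterS => n en; rewrite distrC (le_trans (h n)) //.
exact: le_trans (ler_norm _) (ltW en).
Qed.

Lemma cvg0_of_sqr_norm_le (V : normedModType R) (x : nat -> V) (e : nat -> R) :
  e @ \oo --> 0 -> (forall n, `|x n| ^+ 2 <= e n) -> x @ \oo --> 0.
Proof.
move=> e0 h; apply/cvgrPdist_le => r r0.
have : \forall n \near \oo, `|e n| < r ^+ 2.
  by apply: cvgr0_norm_lt => //; exact: exprn_gt0.
apply: filterS => n en; rewrite sub0r normrN.
rewrite -(ler_pXn2r (n := 2)) ?nnegrE ?normr_ge0 ?(ltW r0) //.
exact: le_trans (h n) (le_trans (ler_norm _) (ltW en)).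
Qed.

Lemma cvg_lipschitz (V W : normedModType R) (f : V -> W) (M : R)
    (x : nat -> V) (l : V) :
  (forall u v, `|f u - f v| <= M * `|u - v|) -> x @ \oo --> l ->
  (fun n => f (x n)) @ \oo --> f l.
Proof.
move=> fM xl; apply: (@cvg_of_dist_le _ _ _ (fun n => M * `|x n - l|)) => //.
rewrite -[X in _ --> X](mulr0 M); apply: cvgMr.
by rewrite -(normr0 V) -(subrr l); apply: cvg_norm; apply: cvgB => //; exact: cvg_cst.
Qed.

(** Here [d] measures strong convexity and [r] plays the midpoint: [m <= V r] bounds [d p q] by the
    excesses of [V p] and [V q] over the infimum [m]. *)
Lemma minimizing_sequence (T : Type) (E : set T) (V : T -> R)
    (d : T -> T -> R) (c : R) :
  E !=set0 -> (forall p, E p -> c <= V p) ->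
  (forall p q, E p -> E q -> exists2 r, E r & d p q + 2 * V r <= V p + V q) ->
  exists m (p : nat -> T), [/\ forall q, E q -> m <= V q, forall n, E (p n),
    forall n, V (p n) <= m + harmonic n &
    forall n k, d (p n) (p k) <= harmonic n + harmonic k].
Proof.
move=> [p0 Ep0] cV mid.
have inf_V : has_inf (V @` E).
  by split; [exists (V p0), p0 | exists c => _ [p Ep <-]; exact: cV].
pose m := inf (V @` E).
have mV q : E q -> m <= V q by move=> Eq; apply: (ge_inf inf_V.2); exists q.
have /choice[p pP] : forall n, exists q, E q /\ V q <= m + harmonic n.
  move=> n.
  have [_ [q Eq <-] Vq] := inf_adherent (harmonic_gt0 n) inf_V.
  by exists q; split=> //; exact: ltW.
exists m, p; split=> // [n|n|n k]; [exact: (pP n).1 | exact: (pP n).2 |].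
have [r Er] := mid _ _ (pP n).1 (pP k).1.
have := mV r Er; have := (pP n).2; have := (pP k).2; lra.
Qed.

End Sequences.

(** * Riesz representation *)

Section Riesz.
Context {R : realType} {H : hilbertType R}.

Lemma midpoint_sqr_norm (x y : H) :
  `|2^-1 *: (x + y)| ^+ 2 + `|x - y| ^+ 2 / 4 = (`|x| ^+ 2 + `|y| ^+ 2) / 2.
Proof. by rewrite sqr_normZ sqr_normD sqr_normB; field. Qed.

(** The representing vector is the minimiser of [|x|^2 - 2 f x], which exists because the
    parallelogram law makes minimising sequences Cauchy. *)
Lemma riesz (f : {scalar H}) (M : R) : (forall x, `|f x| <= M * `|x|) ->
  exists z, forall x, f x = inner x z.
Proof.
move=> fM.
have f_le x : f x <= M * `|x| by exact: le_trans (ler_norm _) (fM x).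
pose V (x : H) := `|x| ^+ 2 - 2 * f x.
have V_lb x : - M ^+ 2 <= V x.
  by rewrite /V; have := f_le x; have := sqr_ge0 (`|x| - M); nra.
have midV x y : `|x - y| ^+ 2 / 2 + 2 * V (2^-1 *: (x + y)) <= V x + V y.
  have := midpoint_sqr_norm x y.
  have fmid : f (2^-1 *: (x + y)) = 2^-1 * (f x + f y).
    by rewrite linearZ_LR raddfD.
  rewrite /V fmid; lra.
have [m [p [mV _ pm pd]]] : exists m (p : nat -> H),
    [/\ forall q, setT q -> m <= V q, forall n, setT (p n),
      forall n, V (p n) <= m + harmonic n &
      forall n k, `|p n - p k| ^+ 2 / 2 <= harmonic n + harmonic k].
  apply: (@minimizing_sequence _ _ setT V (fun x y => `|x - y| ^+ 2 / 2)
            (- M ^+ 2)) => //; first by exists 0.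
  by move=> x y _ _; exists (2^-1 *: (x + y)).
have h0 : (fun n => 2 * harmonic n : R) @ \oo --> (0 : R).
  by rewrite -[X in _ --> X](mulr0 2); apply: cvgMr; exact: cvg_harmonic.
have pc : cvgn p.
  by apply: (cvg_of_sqr_dist h0) => n k; have := pd n k; lra.
set z := limn p in pc.
have Vz : V z <= m.
  have fp : (fun n => f (p n)) @ \oo --> f z.
    apply: (@cvg_lipschitz _ H R f M) pc => u v.
    by have -> : f u - f v = f (u - v) by rewrite raddfB.
  have Vp : (fun n => V (p n)) @ \oo --> V z.
    rewrite /V; under eq_fun do rewrite expr2.
    rewrite expr2; apply: cvgB; last by apply: cvgMr.
    by apply: cvgM; apply: cvg_norm.
  have mh : (fun n => m + harmonic n) @ \oo --> m.
    by rewrite -[X in _ --> X]addr0; apply: (cvgD (cvg_cst m) cvg_harmonic).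
  exact: cvgn_le Vp mh pm.
(* Comparing [V z] with [V (z + s *: x)] gives [0 <= 2 s (inner x z - f x) + s^2 |x|^2]; the reverse
   inequality comes from [- x]. *)
have f_le_inner x : f x <= inner x z.
  suff : 0 <= 2 * (inner x z - f x) by lra.
  apply: (@ge0_of_small _ _ (`|x| ^+ 2)) => s _ _.
  have := le_trans Vz (mV (z + s *: x) I).
  have fzs : f (z + s *: x) = f z + s * f x by rewrite linearD linearZ_LR.
  by rewrite /V fzs sqr_normD sqr_normZ innerZr (innerC z x); lra.
exists z => x; apply/eqP; rewrite eq_le f_le_inner /=.
have := f_le_inner (- x); rewrite innerNl raddfN /=; lra.
Qed.

End Riesz.

(** * Maximal monotone maps: Minty's theorem and resolvents *)

Section Minty.
Context {R : realType} {H : hilbertType R}.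
Implicit Types (B : H -> set H) (x y z : H) (lambda : R).

(** Otherwise adding [(x, u)] to the graph would give a strictly larger monotone map. *)
Lemma maximal_monotone_mem B x u : maximal_monotone B ->
  (forall a b, B a b -> 0 <= inner (u - b) (x - a)) -> B x u.
Proof.
move=> [monoB maxB] xu; apply: contrapT => nBxu.
apply: (maxB (fun a => [set b | B a b \/ (a = x /\ b = u)])).
  move=> a a' b b' [Bab|[-> ->]] [Bab'|[-> ->]].
  - exact: monoB.
  - by rewrite -opprB innerNl -innerNr opprB; exact: xu.
  - exact: xu.
  - by rewrite !subrr inner0l.
split; first by move=> [a b] Bab; left.
by move=> /(_ (x, u)) h; apply/nBxu/h; right.
Qed.

(* Minimise t + (|x|^2 + |u|^2) / 2 over the epigraph E of the Fitzpatrick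
   function of B; first-order optimality at the minimiser (x0, u0) makes
   (- u0, - x0) monotonically related to B, which forces u0 = - x0. *)
Lemma minty_origin B :
  monotone_map B ->
  (forall x u, (forall a b, B a b -> 0 <= inner (u - b) (x - a)) -> B x u) ->
  exists x, B x (- x).
Proof.
move=> monoB memB.
pose E : set (H * H * R) := [set p | forall a b, B a b ->
  inner p.1.1 b + inner a p.1.2 - inner a b <= p.2].
pose V (p : H * H * R) := p.2 + 2^-1 * (`|p.1.1| ^+ 2 + `|p.1.2| ^+ 2).
have E_graph a b : B a b -> E (a, b, inner a b).
  move=> Bab a' b' Bab' /=.
  have := monoB _ _ _ _ Bab Bab'; rewrite !innerE.
  rewrite (innerC b) (innerC b a') (innerC b' a) (innerC b' a'); lra.
(* If [t < inner x u], then [(x, u)] is monotonically related to [B], hence in its graph, and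
   testing [E] on this very pair gives a contradiction. *)
have E_inner x u t : E (x, u, t) -> inner x u <= t.
  move=> Et; rewrite leNgt; apply/negP => tlt.
  have Bxu : B x u.
    apply: memB => a b /Et /=.
    rewrite !innerE (innerC u x) (innerC u a) (innerC b x) (innerC b a); lra.
  have := Et _ _ Bxu => /=; lra.
have E0 : E !=set0.
  have [[a [b /E_graph Eab]]|nB] := pselect (exists a b, B a b).
    by exists (a, b, inner a b).
  by exists (0, 0, 0) => a b Bab; exfalso; apply: nB; exists a, b.
have V0 p : E p -> 0 <= V p.
  case: p => [[x u] t] /E_inner xut; rewrite /V /=.
  have := sqr_ge0 `|x + u|; rewrite sqr_normD; lra.
pose d (p q : H * H * R) := (`|p.1.1 - q.1.1| ^+ 2 + `|p.1.2 - q.1.2| ^+ 2) / 4.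
have midV p q : E p -> E q -> exists2 r, E r & d p q + 2 * V r <= V p + V q.
  case: p => [[x u] t]; case: q => [[y v] s] Ep Eq.
  exists (2^-1 *: (x + y), 2^-1 *: (u + v), 2^-1 * (t + s)).
    move=> a b Bab /=; have := Ep _ _ Bab; have := Eq _ _ Bab => /=.
    rewrite !innerE; lra.
  have := midpoint_sqr_norm x y; have := midpoint_sqr_norm u v.
  rewrite /V /d /=; lra.
have [m [p [mV Ep pm pd]]] := minimizing_sequence E0 V0 midV.
pose x n := (p n).1.1; pose u n := (p n).1.2.
have h0 : (fun n => 4 * harmonic n : R) @ \oo --> (0 : R).
  by rewrite -[X in _ --> X](mulr0 4); apply: cvgMr; exact: cvg_harmonic.
have xc : cvgn x.
  apply: (cvg_of_sqr_dist h0) => n k; have := pd n k; rewrite /d.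
  have := sqr_ge0 `|u n - u k|; rewrite /u /x; lra.
have uc : cvgn u.
  apply: (cvg_of_sqr_dist h0) => n k; have := pd n k; rewrite /d.
  have := sqr_ge0 `|x n - x k|; rewrite /u /x; lra.
set x0 := limn x in xc; set u0 := limn u in uc.
(* Chosen so that [V (x0, u0, t0) = m]. The third components of [p n] need only the upper bound
   supplied by [pm]. *)
pose t0 := m - 2^-1 * (`|x0| ^+ 2 + `|u0| ^+ 2).
have Et0 : E (x0, u0, t0).
  move=> a b Bab /=.
  have lhs : (fun n => inner (x n) b + inner a (u n) - inner a b) @ \oo -->
      inner x0 b + inner a u0 - inner a b.
    apply: cvgB; last exact: cvg_cst.
    by apply: cvgD; apply: cvg_inner => //; exact: cvg_cst.
  have rhs : (fun n => m + harmonic n - 2^-1 * (`|x n| ^+ 2 + `|u n| ^+ 2)) @ \oo --> t0.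
    rewrite /t0; under eq_fun do rewrite !expr2.
    rewrite !expr2; apply: cvgB.
      by rewrite -[X in _ --> X]addr0; apply: (cvgD (cvg_cst m) cvg_harmonic).
    by apply: cvgMr; apply: cvgD; apply: cvgM; apply: cvg_norm.
  apply: (cvgn_le lhs rhs) => n.
  have := Ep n _ _ Bab; have := pm n; rewrite /V /x /u; lra.
have min0 a b : B a b ->
    0 <= inner a b - t0 + inner x0 (a - x0) + inner u0 (b - u0).
  move=> Bab.
  apply: (@ge0_of_small _ _ (2^-1 * (`|a - x0| ^+ 2 + `|b - u0| ^+ 2))) => s s0 s1.
  (* [E] is convex, so it contains the segment from the minimiser to the point
     [(a, b, inner a b)]. *)
  have Es : E (x0 + s *: (a - x0), u0 + s *: (b - u0), t0 + s * (inner a b - t0)).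
    move=> a' b' Bab' /=.
    have := Et0 _ _ Bab'; have := E_graph _ _ Bab _ _ Bab' => /=.
    rewrite -subr_ge0 -(pmulr_rge0 _ s0) => h1.
    have s1' : 0 < 1 - s by rewrite subr_gt0.
    rewrite -subr_ge0 -(pmulr_rge0 _ s1') => h2.
    rewrite !innerE; lra.
  have := mV _ Es; rewrite /V /= (sqr_normD x0) (sqr_normD u0) !sqr_normZ !innerZr.
  rewrite {1}/t0; lra.
have x0u0 := E_inner _ _ _ Et0.
(* By [min0] the right-hand side is at least [t0 + |x0|^2 + |u0|^2 + inner x0 u0], and [t0] is at
   least [inner x0 u0]. *)
have ab_ge a b : B a b -> `|x0 + u0| ^+ 2 <= inner (- x0 - b) (- u0 - a).
  move=> /min0; rewrite sqr_normD !sqr_norm_inner !innerE.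
  rewrite (innerC b u0) (innerC b a); lra.
have B0 : B (- u0) (- x0).
  by apply: memB => a b /ab_ge; apply: le_trans; exact: sqr_ge0.
(* Tested on the pair of [B0] itself, the right-hand side vanishes. *)
have := ab_ge _ _ B0; rewrite subrr inner0l => n0.
have /eqP : `|x0 + u0| ^+ 2 == 0 by rewrite eq_le n0 sqr_ge0.
move/eqP; rewrite sqrf_eq0 normr_eq0 addr_eq0 => /eqP x0E.
by exists x0; rewrite {1}x0E.
Qed.

(** Apply [minty_origin] to [G = lambda B - z]: [- x] in [G x] means that [z - x] lies in
    [lambda B x]. *)
Lemma resolvent_exists B lambda z : maximal_monotone B -> 0 < lambda ->
  exists x, resolvent_map lambda B z x.
Proof.
move=> maxB lambda0.
pose G (x : H) : set H := [set u | B x (lambda^-1 *: (u + z))].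
have shift (u v : H) :
    lambda^-1 *: (u + z) - lambda^-1 *: (v + z) = lambda^-1 *: (u - v).
  by rewrite -scalerBr opprD addrACA subrr addr0.
have [] := @minty_origin G.
- move=> x y u v Gxu Gyv; have := maxB.1 _ _ _ _ Gxu Gyv.
  by rewrite shift innerZl pmulr_rge0 // invr_gt0.
- move=> x u xu; apply: (maximal_monotone_mem maxB) => a b Bab.
  have bE : b = lambda^-1 *: ((lambda *: b - z) + z).
    by rewrite addrNK scalerA mulVf ?gt_eqF // scale1r.
  rewrite bE shift innerZl pmulr_rge0 ?invr_gt0 //; apply: xu.
  by rewrite /G /= -bE.
move=> x; rewrite /G /= => Bx; exists x, (lambda^-1 *: (- x + z)) => //.
by rewrite scalerA mulfV ?gt_eqF // scale1r addrA subrr add0r.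
Qed.

Lemma resolvent_mem B lambda z : maximal_monotone B -> 0 < lambda ->
  B (resolvent lambda B z) (lambda^-1 *: (z - resolvent lambda B z)).
Proof.
move=> maxB lambda0.
have := xgetPex 0 (resolvent_exists z maxB lambda0).
rewrite -/(resolvent lambda B z); set J := resolvent lambda B z.
move=> [u BJu <-].
by rewrite addrC addKr scalerA mulVf ?gt_eqF // scale1r.
Qed.

(** Monotonicity of [B] at the two points given by [resolvent_mem], with the factor [lambda^-1]
    cleared. *)
Lemma resolvent_firmly_nonexpansive B lambda y z :
  maximal_monotone B -> 0 < lambda ->
  0 <= inner ((y - resolvent lambda B y) - (z - resolvent lambda B z))
             (resolvent lambda B y - resolvent lambda B z).
Proof.
move=> maxB lambda0.
have := maxB.1 _ _ _ _ (resolvent_mem y maxB lambda0) (resolvent_mem z maxB lambda0).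
by rewrite -scalerBr innerZl pmulr_rge0 // invr_gt0.
Qed.

(** By oddness [- J] solves the inclusion that defines [J']; monotonicity between the two solutions
    gives [- |J' + J|^2 >= 0]. *)
Lemma resolventN B lambda z : maximal_monotone B -> odd_map B -> 0 < lambda ->
  resolvent lambda B (- z) = - resolvent lambda B z.
Proof.
move=> maxB oddB lambda0.
have := resolvent_mem (- z) maxB lambda0; set J' := resolvent _ _ (- z) => BJ'.
have := resolvent_mem z maxB lambda0; set J := resolvent _ _ z => BJ.
have BNJ : B (- J) (lambda^-1 *: (- z + J)).
  by rewrite oddB; eexists; first exact: BJ; rewrite -scalerN opprB addrC.
have := maxB.1 _ _ _ _ BJ' BNJ.
rewrite -scalerBr innerZl pmulr_rge0 ?invr_gt0 // opprD addrACA subrr add0r.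
have -> : - J' - J = - (J' - - J) by rewrite opprB addrC.
rewrite innerNl -sqr_norm_inner oppr_ge0 => n0.
apply/eqP; rewrite -subr_eq0 -normr_eq0 -sqrf_eq0.
by rewrite eq_le n0 sqr_ge0.
Qed.

(** Monotonicity against a fixed graph point passes to the limit, and maximality then puts the limit
    in the graph. *)
Lemma maximal_monotone_closed B (x u : nat -> H) (x0 u0 : H) :
  maximal_monotone B -> (forall n, B (x n) (u n)) ->
  x @ \oo --> x0 -> u @ \oo --> u0 -> B x0 u0.
Proof.
move=> maxB Bxu xx0 uu0; apply: (maximal_monotone_mem maxB) => a b Bab.
have c : (fun n => inner (u n - b) (x n - a)) @ \oo --> inner (u0 - b) (x0 - a).
  by apply: cvg_inner; apply: cvgB => //; exact: cvg_cst.
by apply: (cvgn_le (cvg_cst 0) c) => n; exact: (maxB.1 _ _ _ _ (Bxu n) Bab).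
Qed.

End Minty.

(** * The adjoint and the norm of [adjoint A \o A] *)

Section Adjoint.
Context {R : realType} {H1 H2 : hilbertType R}.
Variable A : {linear H1 -> H2}.
Hypothesis A_bounded : bounded_fun_norm A.

Lemma bounded_linear_norm_le : exists2 M, 0 <= M & forall x, `|A x| <= M * `|x|.
Proof.
have [M AM] := A_bounded 1; exists M => [|x].
  by apply: le_trans (AM 0 _); rewrite ?normr0.
have [->|x0] := eqVneq x 0; first by rewrite linear0 !normr0 mulr0.
have n0 : 0 < `|x| by rewrite normr_gt0.
have := AM (`|x|^-1 *: x).
rewrite linearZ_LR /= !normrZ ger0_norm ?invr_ge0 // mulVf ?gt_eqF // => /(_ (lexx _)).
by rewrite ler_pdivrMl // mulrC.
Qed.

(** Riesz applied to the bounded functional [inner (A x) y] of [x] shows that the default value of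
    [xget] is not taken. *)
Lemma adjointP x y : inner (A x) y = inner x (adjoint A y).
Proof.
have [M M0 AM] := bounded_linear_norm_le.
have lin : scalar (fun x => inner (A x) y).
  by move=> a u v; rewrite linearP innerDl innerZl.
pose f : {scalar H1} := HB.pack (fun x => inner (A x) y)
  (GRing.isLinear.Build R H1 R _ _ lin).
have [z fz] : exists z, forall x, f x = inner x z.
  apply: (@riesz _ _ f (M * `|y|)) => u.
  have le v : inner (A v) y <= M * `|y| * `|v|.
    apply: le_trans (inner_le_norm _ _) _.
    by rewrite mulrAC ler_wpM2r.
  have := le (- u); rewrite normrN linearN innerNl => leN.
  by rewrite ler_norml le andbT lerNl.
have ex : exists z, [set z | forall x, inner (A x) y = inner x z] z by exists z.
exact: (xgetPex 0 ex).
Qed.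

Lemma adjointB y z : adjoint A (y - z) = adjoint A y - adjoint A z.
Proof.
by apply: inner_injr => x; rewrite innerDr innerNr -!adjointP innerDr innerNr.
Qed.

Lemma adjointN y : adjoint A (- y) = - adjoint A y.
Proof. by apply: inner_injr => x; rewrite innerNr -!adjointP innerNr. Qed.

Lemma adjoint0 : adjoint A 0 = 0.
Proof. by apply: inner_injr => x; rewrite -adjointP !inner0r. Qed.

Lemma adjointZ a y : adjoint A (a *: y) = a *: adjoint A y.
Proof. by apply: inner_injr => x; rewrite innerZr -!adjointP innerZr. Qed.

Let L := opnorm (adjoint A \o A).

Lemma adjoint_norm_le M y : 0 <= M -> (forall x, `|A x| <= M * `|x|) ->
  `|adjoint A y| <= M * `|y|.
Proof.
move=> M0 AM; set z := adjoint A y.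
have [->|z0] := eqVneq z 0; first by rewrite normr0 mulr_ge0.
have zp : 0 < `|z| by rewrite normr_gt0.
rewrite -(ler_pM2l zp) -expr2 sqr_norm_inner {2}/z -adjointP.
apply: le_trans (inner_le_norm _ _) _.
by rewrite mulrA ler_wpM2r // mulrC.
Qed.

Lemma opnorm_adjoint_comp :
  0 <= L /\ forall x, `|adjoint A (A x)| <= L * `|x|.
Proof.
have [M M0 AM] := bounded_linear_norm_le.
(* The set is bounded, so [sup] in [opnorm] is a genuine supremum. *)
have ub : has_ubound [set `|(adjoint A \o A) z| | z in [set z : H1 | `|z| <= 1]].
  exists (M * M) => _ [z /= z1 <-].
  apply: le_trans (adjoint_norm_le _ M0 AM) _; rewrite ler_wpM2l //.
  by apply: le_trans (AM z) _; rewrite -[leRHS]mulr1 ler_wpM2l.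
split=> [|x].
  apply: le_trans (normr_ge0 ((adjoint A \o A) 0)) _.
  by apply: (ub_le_sup ub); exists 0 => //=; rewrite normr0.
have [->|x0] := eqVneq x 0.
  by rewrite linear0 adjoint0 !normr0 mulr0.
have n0 : 0 < `|x| by rewrite normr_gt0.
have : `|adjoint A (A (`|x|^-1 *: x))| <= L.
  apply: (ub_le_sup ub); exists (`|x|^-1 *: x) => //=.
  by rewrite normrZ ger0_norm ?invr_ge0 // mulVf ?gt_eqF.
rewrite linearZ_LR /= adjointZ normrZ ger0_norm ?invr_ge0 //.
by rewrite ler_pdivrMl // mulrC.
Qed.

Lemma sqr_norm_le_opnorm x : `|A x| ^+ 2 <= L * `|x| ^+ 2.
Proof.
rewrite sqr_norm_inner adjointP; apply: le_trans (inner_le_norm _ _) _.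
by rewrite expr2 mulrA [leRHS]mulrC ler_wpM2l // opnorm_adjoint_comp.2.
Qed.

(** With [z = adjoint A y], [|z|^4 = (inner (A z) y)^2 <= |A z|^2 |y|^2 <= L |z|^2 |y|^2]; this
    avoids identifying [L] with the squared norm of [A]. *)
Lemma sqr_norm_adjoint_le y : `|adjoint A y| ^+ 2 <= L * `|y| ^+ 2.
Proof.
set z := adjoint A y.
have [->|z0] := eqVneq z 0.
  by rewrite normr0 expr0n mulr_ge0 ?opnorm_adjoint_comp.1 ?sqr_ge0.
have zp : 0 < `|z| ^+ 2 by rewrite exprn_gt0 // normr_gt0.
rewrite -(ler_pM2l zp) -expr2 {1}sqr_norm_inner {2}/z -adjointP.
have le0 : 0 <= inner (A z) y by rewrite adjointP -/z -sqr_norm_inner ltW.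
apply: (@le_trans _ _ ((`|A z| * `|y|) ^+ 2)).
  by rewrite ler_pXn2r ?nnegrE ?mulr_ge0 // inner_le_norm.
rewrite exprMn [leRHS]mulrCA [leRHS]mulrA ler_wpM2r ?sqr_ge0 //.
exact: sqr_norm_le_opnorm.
Qed.

End Adjoint.

(* For an odd nonexpansive step the norms |x k + x m| decrease while the
   differences vanish, so |x n + x k| >= 2 lim |x j|; the parallelogram law then
   bounds |x n - x k| by norms only. *)
Lemma odd_nonexpansive_cvg (R : realType) (H : hilbertType R) (x : nat -> H) :
  (forall n k, `|x n.+1 + x k.+1| <= `|x n + x k|) ->
  (fun k => x k.+1 - x k) @ \oo --> 0 -> cvgn x.
Proof.
move=> xD xB.
pose a n := `|x n| ^+ 2.
have a_anti : {homo a : n m / (n <= m)%N >-> m <= n}.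
  apply: homo_leq => // [u v w uv wu|n]; first exact: le_trans wu uv.
  have : `|x n.+1 + x n.+1| ^+ 2 <= `|x n + x n| ^+ 2.
    by rewrite ler_pXn2r ?nnegrE ?normr_ge0.
  by rewrite !sqr_norm_double /a; lra.
have ac : cvgn a.
  apply: nonincreasing_is_cvgn => //.
  by exists 0 => _ [n _ <-]; exact: sqr_ge0.
set D := limn a in ac.
have aD n : D <= a n by exact: nonincreasing_cvgn_ge.
(* Telescoping: differences at any fixed lag also vanish. *)
have xB_shift n : (fun j => x (j + n)%N - x j) @ \oo --> 0.
  elim: n => [|n IHn].
    by under eq_fun do rewrite addn0 subrr; exact: cvg_cst.
  have xBn : (fun j => x (j + n).+1 - x (j + n)%N) @ \oo --> 0.
    by move: xB; rewrite -(cvg_shiftn n).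
  under eq_fun => j do rewrite addnS -(subrKA (x (j + n)%N)).
  by rewrite -(addr0 0); exact: cvgD.
have sum_shift n k j : `|x (j + n)%N + x (j + k)%N| <= `|x n + x k|.
  elim: j => [//|j IHj]; rewrite !addSn; exact: le_trans (xD _ _) IHj.
(* The parallelogram law gives [|x (j + n) + x (j + k)|^2 >= 4 D - |y j|^2]; the left side is at
   most [|x n + x k|^2], and [j] tends to infinity. *)
have sum_ge n k : 4 * D <= `|x n + x k| ^+ 2.
  pose y j := x (j + n)%N - x (j + k)%N.
  have y0 : y @ \oo --> 0.
    have -> : y = (fun j => (x (j + n)%N - x j) - (x (j + k)%N - x j)).
      by apply/funext => j; rewrite opprB subrKA.
    by rewrite -(subrr 0); exact: cvgB.
  have y2 : (fun j => 4 * D - `|y j| * `|y j|) @ \oo --> 4 * D - `|0 : H| * `|0 : H|.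
    by apply: cvgB; [exact: cvg_cst | apply: cvgM; apply: cvg_norm].
  rewrite normr0 mulr0 subr0 in y2.
  apply: (cvgn_le y2 (cvg_cst _)) => j.
  apply: (@le_trans _ _ (`|x (j + n)%N + x (j + k)%N| ^+ 2)).
    have := aD (j + n)%N; have := aD (j + k)%N.
    by rewrite /a -expr2 /y sqr_normB sqr_normD; lra.
  by rewrite ler_pXn2r ?nnegrE ?normr_ge0.
(* By the parallelogram law and [sum_ge], [|x n - x k|^2 <= 2 (a n - D) + 2 (a k - D)]. *)
have e0 : (fun n => 2 * (a n - D)) @ \oo --> 0.
  rewrite -(mulr0 2); apply: cvgMr; rewrite -(subrr D).
  by apply: cvgB => //; exact: cvg_cst.
apply: (cvg_of_sqr_dist e0) => n k.
have := sum_ge n k; rewrite sqr_normD sqr_normB /a; lra.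
Qed.

(** * The iteration map and convergence of its orbits *)

Section ForwardBackward.
Context {R : realType} {H1 H2 : hilbertType R}.
Variables (B1 : H1 -> set H1) (F1 : H2 -> set H2) (A : {linear H1 -> H2}).
Variables (lambda gamma : R).
Hypotheses (B1_odd : odd_map B1) (B1_max : maximal_monotone B1).
Hypotheses (F1_odd : odd_map F1) (F1_max : maximal_monotone F1).
Hypotheses (A_bounded : bounded_fun_norm A).
Hypotheses (lambda_gt0 : 0 < lambda) (gamma_gt0 : 0 < gamma).

Let residual (p : H1) := A p - resolvent lambda F1 (A p).
Let forward (p : H1) := p - gamma *: adjoint A (residual p).
Let step (p : H1) := resolvent lambda B1 (forward p).

(** Expand the square: firm nonexpansiveness bounds the cross term below by [2 gamma |w|^2], and
    [sqr_norm_adjoint_le] bounds the quadratic term by [gamma^2 L |w|^2]. *)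
Lemma forward_contraction p q :
  `|forward p - forward q| ^+ 2 +
    gamma * (2 - gamma * opnorm (adjoint A \o A)) * `|residual p - residual q| ^+ 2
  <= `|p - q| ^+ 2.
Proof.
set w := residual p - residual q.
have -> : forward p - forward q = (p - q) - gamma *: adjoint A w.
  apply: inner_injr => z.
  by rewrite /forward /w (adjointB A_bounded (residual p)) !innerE; lra.
have fw : `|w| ^+ 2 <= inner (p - q) (adjoint A w).
  have := resolvent_firmly_nonexpansive (A p) (A q) F1_max lambda_gt0.
  rewrite -/(residual p) -/(residual q) -/w => wJ.
  rewrite -adjointP // innerC sqr_norm_inner -subr_ge0 -innerNr -innerDr.
  suff -> : A (p - q) - w =
    resolvent lambda F1 (A p) - resolvent lambda F1 (A q) by [].
  by apply: inner_injr => z; rewrite linearB /w /residual !innerE; lra.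
have aw := sqr_norm_adjoint_le A_bounded w.
rewrite sqr_normB sqr_normZ innerZr.
have := ler_wpM2l (ltW gamma_gt0) fw.
have := ler_wpM2l (sqr_ge0 gamma) aw; lra.
Qed.

(** Split the forward difference into its resolvent part and the remainder; their inner product is
    nonnegative by firm nonexpansiveness. *)
Lemma step_contraction p q :
  `|step p - step q| ^+ 2
  + gamma * (2 - gamma * opnorm (adjoint A \o A)) * `|residual p - residual q| ^+ 2
  + `|(forward p - step p) - (forward q - step q)| ^+ 2 <= `|p - q| ^+ 2.
Proof.
apply: le_trans (forward_contraction p q).
have := resolvent_firmly_nonexpansive (forward p) (forward q) B1_max lambda_gt0.
rewrite -/(step p) -/(step q).
have -> : forward p - forward q =
    ((forward p - step p) - (forward q - step q)) + (step p - step q).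
  by apply: inner_injr => z; rewrite !innerE; lra.
by rewrite (sqr_normD (_ - _ - (_ - _))); lra.
Qed.

Lemma residualN p : residual (- p) = - residual p.
Proof. by rewrite /residual linearN resolventN // -opprD. Qed.

Lemma forwardN p : forward (- p) = - forward p.
Proof. by rewrite /forward residualN adjointN // scalerN -opprD. Qed.

Lemma stepN p : step (- p) = - step p.
Proof. by rewrite /step forwardN resolventN. Qed.

Hypothesis gamma_lt : gamma * opnorm (adjoint A \o A) < 2.
Let c := gamma * (2 - gamma * opnorm (adjoint A \o A)).

(** Take [q = - p] in [step_contraction]: by oddness every difference doubles, and the common factor
    4 cancels. *)
Lemma step_norm_decrease p :
  `|step p| ^+ 2 + c * `|residual p| ^+ 2 + `|forward p - step p| ^+ 2 <= `|p| ^+ 2.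
Proof.
have := step_contraction p (- p); rewrite -/c.
rewrite stepN residualN forwardN -opprD !opprK.
by rewrite !sqr_norm_double; lra.
Qed.

(** Oddness turns nonexpansiveness between [p] and [- q] into a bound on sums. *)
Lemma step_sum_norm p q : `|step p + step q| <= `|p + q|.
Proof.
have c0 : 0 < c by rewrite mulr_gt0 // subr_gt0.
have := step_contraction p (- q); rewrite -/c stepN !opprK => h.
rewrite -(ler_pXn2r (n := 2)) ?nnegrE ?normr_ge0 //.
apply: le_trans h; rewrite -addrA lerDl addr_ge0 ?sqr_ge0 //.
by rewrite mulr_ge0 ?sqr_ge0 // ltW.
Qed.

Lemma forward_backward_cvg (x : nat -> H1) : (forall k, x k.+1 = step (x k)) ->
  exists xstar, solution_set B1 F1 A xstar /\ x @ \oo --> xstar.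
Proof.
move=> xS.
have c0 : 0 < c by rewrite mulr_gt0 // subr_gt0.
pose a k := `|x k| ^+ 2.
have dec k : a k.+1 + c * `|residual (x k)| ^+ 2
    + `|forward (x k) - x k.+1| ^+ 2 <= a k.
  by rewrite /a xS; exact: step_norm_decrease.
have res_ge0 k : 0 <= c * `|residual (x k)| ^+ 2.
  by rewrite mulr_ge0 ?sqr_ge0 // ltW.
have ac : cvgn a.
  apply: nonincreasing_is_cvgn.
    apply: homo_leq => // [u v w uv wu|n]; first exact: le_trans wu uv.
    by have := dec n; have := res_ge0 n; have := sqr_ge0 `|forward (x n) - x n.+1|; lra.
  by exists 0 => _ [n _ <-]; exact: sqr_ge0.
(* These decrements tend to 0 and dominate both nonnegative extra terms of [dec], which yields [w0]
   and [v0]. *)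
have aB : (fun k => a k - a k.+1) @ \oo --> 0.
  by rewrite -(subrr (limn a)); apply: cvgB => //; rewrite (cvg_shiftS a).
have w0 : (fun k => residual (x k)) @ \oo --> 0.
  have caB : (fun k => c^-1 * (a k - a k.+1)) @ \oo --> 0.
    by rewrite -(mulr0 c^-1); apply: cvgMr.
  apply: (cvg0_of_sqr_norm_le caB) => k; rewrite ler_pdivlMl //.
  by have := dec k; have := sqr_ge0 `|forward (x k) - x k.+1|; lra.
have v0 : (fun k => forward (x k) - x k.+1) @ \oo --> 0.
  apply: (cvg0_of_sqr_norm_le aB) => k.
  by have := dec k; have := res_ge0 k; lra.
have [M M0 AM] := bounded_linear_norm_le A_bounded.
have adjw0 : (fun k => adjoint A (residual (x k))) @ \oo --> 0.
  rewrite -(adjoint0 A_bounded).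
  apply: cvg_lipschitz w0 => u v; rewrite -adjointB //.
  exact: adjoint_norm_le M0 AM.
have xB : (fun k => x k.+1 - x k) @ \oo --> 0.
  have -> : (fun k => x k.+1 - x k) =
      (fun k => - (forward (x k) - x k.+1) - gamma *: adjoint A (residual (x k))).
    by apply/funext => k; apply: inner_injr => z; rewrite /forward !innerE; lra.
  have -> : 0 = - 0 - gamma *: 0 :> H1 by rewrite scaler0 subr0 oppr0.
  apply: cvgB; first exact: cvgN.
  exact: cvgZr.
have xc : cvgn x.
  by apply: odd_nonexpansive_cvg => // n k; rewrite !xS step_sum_norm.
set xs := limn x in xc.
have scale0 (H : hilbertType R) (u : nat -> H) : u @ \oo --> 0 ->
    (fun k => lambda^-1 *: u k) @ \oo --> 0.
  by move=> u0; rewrite -(scaler0 _ lambda^-1); exact: cvgZr.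
(* [B1] at [x k.+1] contains [lambda^-1 *: (forward (x k) - x k.+1)], which tends to 0, so
   closedness of the graph applies. *)
exists xs; split => //; split.
  have xS' : (fun k => x k.+1) @ \oo --> xs by rewrite (cvg_shiftS x).
  apply: (maximal_monotone_closed B1_max _ xS' (scale0 _ _ v0)) => k.
  by rewrite xS; exact: resolvent_mem.
(* The vectors [lambda^-1 *: residual (x k)] lie in [F1] at these resolvent points rather than at
   [A (x k)], so the resolvent points must be shown to tend to [A xs]. *)
have Jx : (fun k => resolvent lambda F1 (A (x k))) @ \oo --> A xs.
  have -> : (fun k => resolvent lambda F1 (A (x k))) =
      (fun k => A (x k) - residual (x k)).
    by apply/funext => k; rewrite /residual opprB addrC addrNK.
  rewrite -[A xs]subr0; apply: cvgB => //.
  by apply: (@cvg_lipschitz _ _ _ A M) xc => u v; rewrite -linearB.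
apply: (maximal_monotone_closed F1_max _ Jx (scale0 _ _ w0)) => k.
exact: resolvent_mem.
Qed.

End ForwardBackward.

(* The bound on gamma is read in the extended reals, where 2 / 0 = +oo: it is
   gamma < 2 / L when 0 < L, and void when L = 0. *)
Theorem theorem4p3 (R : realType) (H1 H2 : hilbertType R)
    (B1 : H1 -> set H1) (F1 : H2 -> set H2) (A : {linear H1 -> H2})
    (B1_odd : odd_map B1) (B1_max : maximal_monotone B1)
    (F1_odd : odd_map F1) (F1_max : maximal_monotone F1)
    (A_bounded : bounded_fun_norm A)
    (L : R) (L_def : L = opnorm (adjoint A \o A))
    (lambda gamma : R) (lambda_gt0 : 0 < lambda)
    (gamma_gt0 : 0 < gamma) (gamma_lt : (gamma%:E < 2%:E / L%:E)%E)
    (x0 : H1) (x : nat -> H1) (x_init : x 0%N = x0)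
    (x_rec : forall k : nat, x k.+1 =
       resolvent lambda B1
         (x k - gamma *: adjoint A (A (x k) - resolvent lambda F1 (A (x k))))) :
  exists xstar : H1,
    solution_set B1 F1 A xstar /\ x k @[k --> \oo] --> xstar.
Proof.
apply: (forward_backward_cvg B1_odd B1_max F1_odd F1_max A_bounded lambda_gt0
          gamma_gt0 _ x_rec).
rewrite -L_def.
have L0 : 0 <= L by rewrite L_def; exact: (opnorm_adjoint_comp A_bounded).1.
(* For [L = 0] the goal [gamma * L < 2] reads [0 < 2]; otherwise the extended quotient is a real
   one. *)
have [->|Ln0] := eqVneq L 0; first by rewrite mulr0.
move: gamma_lt; rewrite inver (negbTE Ln0) -EFinM lte_fin.
by rewrite ltr_pdivlMr // lt_neqAle eq_sym Ln0.
Qed.
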